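(* Let $p$ be a prime and $n\ge 2$ an integer with base-$p$ expansion $n=n_0+n_1p+\cdots+n_kp^k$, where $n_0,\ldots,n_k\in\{0,1,\ldots,p-1\}$ and $n_k>0$. Define \[ P := \{ b_0+b_1p+\cdots+b_kp^k : 0\le b_j\le n_j,\ j=0,1,\ldots,k\}\setminus\{0,n\}, \] which is a subset of $[n-1]$ with $|P|=\prod_{j=0}^k(n_j+1)-2$. For each composition $\beta=(\beta_1,\ldots,\beta_\ell)$ of $n$ write the base-$p$ digits of each part as $\beta_i=\sum_{j=0}^k\beta_{ij}p^j$ with $\beta_{ij}\in\{0,\ldots,p-1\}$ (padding with zeros). For each $T\subseteq P$ define \[ r(T) := \sum_{\substack{\beta\models n,\ D(\beta)\subseteq T\\ \beta_{1j}+\cdots+\beta_{\ell j}=n_j\ \forall j}} (-1)^{|T|-|D(\beta)|}\prod_{j=0}^k\binom{n_j}{\beta_{1j},\ldots,\beta_{\ell j}}. \] Then for every $i\in\mathbb{Z}_p$, \[ c_{p,i}(n)=\begin{cases} 2^{\,n+1-\prod_{j=0}^k(n_j+1)}\,\bigl|\{T\subseteq P: r(T)\equiv i \pmod p\}\bigr| & \text{if } p=2 \text{ or } i=0 \text{ or } n_0=\cdots=n_{k-1}=p-1,\\ 2^{\,n-\prod_{j=0}^k(n_j+1)}\,\bigl|\{T\subseteq P: r(T)\equiv i \text{ or } r(T)\equiv -i \pmod p\}\bigr| & \text{otherwise.}\end{cases} \]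
   Context: For a permutation $w$ of $[n]=\{1,\ldots,n\}$, its descent set is $D(w)=\{i\in[n-1]: w(i)>w(i+1)\}$. A composition of $n$ (written $\alpha\models n$) is a sequence $\alpha=(\alpha_1,\ldots,\alpha_\ell)$ of positive integers with sum $n$; its length is $\ell(\alpha)=\ell$ and its descent set is $D(\alpha)=\{\alpha_1,\alpha_1+\alpha_2,\ldots,\alpha_1+\cdots+\alpha_{\ell-1}\}\subseteq[n-1]$. The ribbon number of $\alpha$ is $r_\alpha=|\{w\in\mathfrak{S}_n: D(w)=D(\alpha)\}|$. For a prime $p$ and $i\in\mathbb{Z}_p$, $c_{p,i}(n)$ is the number of compositions $\alpha\models n$ with $r_\alpha\equiv i\pmod p$. Multinomial coefficients $\binom{m}{m_1,\ldots,m_k}$ (nonnegative entries) equal $m!/(m_1!\cdots m_k!)$ if $m_1+\cdots+m_k=m$ and $0$ otherwise. *)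

(* Defs.v *)
From HB Require Import structures.
From mathcomp Require Import all_boot all_order all_algebra all_fingroup.
Set Implicit Arguments. Unset Strict Implicit. Unset Printing Implicit Defensive.
Import GRing.Theory Num.Theory.

(* Positions/values of w : 'S_n are 0-indexed; the 1-indexed descent
   i in [n-1] (w(i) > w(i+1)) corresponds to 0-indexed w(i-1) > w(i). *)
Definition wval (n : nat) (w : 'S_n) (k : nat) : nat :=
  oapp (fun o : 'I_n => val (w o)) 0%N (insub k : option 'I_n).

Definition desc_perm (n : nat) (w : 'S_n) : {set 'I_n} :=
  [set i : 'I_n | (0 < i)%N && (wval w i.-1 > wval w i)%N].

Definition is_comp (n : nat) (a : seq nat) : bool :=
  all (fun x => 0 < x)%N a && (sumn a == n).

Definition psums (a : seq nat) : seq nat :=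
  [seq sumn (take m a) | m <- iota 1 (size a).-1].

Definition desc_comp (n : nat) (a : seq nat) : {set 'I_n} :=
  [set i : 'I_n | val i \in psums a].

Definition ribbon (n : nat) (a : seq nat) : nat :=
  #|[set w : 'S_n | desc_perm w == desc_comp n a]|.

(* c_{p,i}(n): number of compositions alpha of n with r_alpha = i (mod p).
   Every composition of n >= 1 has length l <= n and parts <= n, so it is
   represented exactly once as an l.-tuple of 'I_n.+1 (l < n.+1). *)
Definition cpi (p i n : nat) : nat :=
  \sum_(l < n.+1)
    #|[set t : l.-tuple 'I_n.+1 |
        is_comp n (map val t) && (ribbon n (map val t) %% p == i %% p)]|.

Definition digit (p j m : nat) : nat := (m %/ p ^ j) %% p.

Definition kdeg (p n : nat) : nat := trunc_log p n.

Definition prodP (p n : nat) : nat := \prod_(j < (kdeg p n).+1) (digit p j n).+1.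

Definition Pset (p n : nat) : {set 'I_n} :=
  [set x : 'I_n | (0 < x)%N &&
     [exists b : {ffun 'I_(kdeg p n).+1 -> 'I_p},
        [forall j, (b j <= digit p j n)%N] &&
        (val x == \sum_(j < (kdeg p n).+1) b j * p ^ j)%N]].

Definition multinom (m : nat) (s : seq nat) : nat :=
  if sumn s == m then (m`! %/ \prod_(x <- s) x`!)%N else 0%N.

Definition rT_term (p n : nat) (T : {set 'I_n}) (b : seq nat) : int :=
  if is_comp n b && (desc_comp n b \subset T) &&
     [forall j : 'I_(kdeg p n).+1,
        sumn [seq digit p j x | x <- b] == digit p j n]
  then ((-1) ^+ (#|T| - #|desc_comp n b|)%N *
        (\prod_(j < (kdeg p n).+1) multinom (digit p j n) [seq digit p j x | x <- b])%:Z)%R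
  else 0%R.

Definition rT (p n : nat) (T : {set 'I_n}) : int :=
  (\sum_(l < n.+1) \sum_(t : l.-tuple 'I_n.+1) rT_term p T (map val t))%R.

(* Main.v *)
(** A permutation [w] with [D(w)] contained in [D(beta)] is one that increases on
    the blocks of [beta]; these are transversal to the Young subgroup of
    [beta], so there are [multinom n beta] of them, and Moebius inversion over
    subsets writes [r_alpha] as an alternating sum of multinomials.  By Lucas's
    theorem the multinomial of [beta] is nonzero modulo [p] only if the digits of
    the parts add up without carry, which forces [D(beta)] into [P].  Hence
    [r_alpha = (-1)^|D(alpha) \ P| r(D(alpha) /\ P)] modulo [p], and it remains to
    count the subsets of [[n-1] \ P] according to parity; [[n-1] \ P] is empty
    exactly when all the digits of [n] but the leading one equal [p-1]. *)

Require Import Defs.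
From HB Require Import structures.
From mathcomp Require Import all_boot all_order all_algebra all_fingroup.
From mathcomp Require Import zify.
Set Implicit Arguments. Unset Strict Implicit. Unset Printing Implicit Defensive.
Import GRing.Theory Num.Theory.

(** * Permutations and the fibres of a function *)

(** Induction on [#|J|]: after removing [i], each permutation factors uniquely as one moving only
    the fibres over [J :\ i], followed by one supported on the fibre [B] of [i]. For [J] full the
    count is the order of a Young subgroup. *)
Lemma card_fibre_perms (T I : finType) (f : T -> I) (J : {set I}) :
  #|[set s : {perm T} | [forall x, (f (s x) == f x) &&
       ((f x \notin J) ==> (s x == x))]]|
  = \prod_(i in J) #|[set x | f x == i]|`!.
Proof.
elim: {J}_.+1 {-2}J (ltnSn #|J|) => // m IHm J; rewrite ltnS => leJm.
have [->|[i iJ]] := set_0Vmem J.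
  rewrite big_set0 -(cards1 (1%g : {perm T})); apply: eq_card => s.
  rewrite !inE; apply/forallP/eqP => [H|-> x].
    by apply/permP=> x; have := H x; rewrite inE perm1 => /andP[_ /eqP].
  by rewrite perm1 !eqxx implybT.
rewrite (big_setD1 i) //= -IHm; last first.
  by rewrite (leq_trans _ leJm) // (cardsD1 i J) iJ.
set B := [set x | f x == i]; rewrite -(card_perm B).
set Y := finset _; set Y' := finset _.
have fixY (s : {perm T}) x : s \in Y' -> f x \notin J :\ i -> s x = x.
  by rewrite inE => /forallP/(_ x)/andP[_ /implyP H] /H /eqP.
have presY (s : {perm T}) x : s \in Y' -> f (s x) = f x.
  by rewrite inE => /forallP/(_ x)/andP[/eqP].
have presB (s : {perm T}) x : perm_on B s -> f (s x) = f x.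
  move=> sB; case: (boolP (x \in B)) => [xB|/(out_perm sB)-> //].
  have := perm_closed x sB; rewrite xB inE => /eqP->.
  by move: xB; rewrite inE => /eqP.
have fixB (s : {perm T}) x : perm_on B s -> f x != i -> s x = x.
  by move=> sB fx; apply: (out_perm sB); rewrite inE.
rewrite mulnC -[#|perm_on B|]cardsE -cardsX.
pose g (u : {perm T} * {perm T}) := (u.1 * u.2)%g.
rewrite -(card_in_imset (f := g)).
  apply: eq_card => s; apply/idP/imsetP.
    rewrite inE => /forallP sP.
    have fs x : f (s x) = f x by have /andP[/eqP] := sP x.
    have sN : s \in 'N(B | 'P)%g.
      by apply/astabsP=> x; rewrite !inE /= /aperm fs.
    have rB : perm_on B (restr_perm B s) by apply: restr_perm_on.
    (* The restriction of [s] to [B] is the second factor; cancelling it from [s] leaves the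
       first. *)
    exists ((s * (restr_perm B s)^-1)%g, restr_perm B s); last by rewrite /g /= mulgKV.
    apply/setXP; split; last by rewrite inE; exact: rB.
    rewrite inE; apply/forallP=> x; rewrite permM.
    have rV := perm_onV rB.
    rewrite presB // fs eqxx /=; apply/implyP; rewrite !inE negb_and negbK.
    case: (eqVneq (f x) i) => [fx _|nfx /= fJ].
      by rewrite -(restr_permE sN) ?permK // inE fx.
    have /andP[_ /implyP/(_ fJ)/eqP ->] := sP x.
    by rewrite fixB.
  case=> [[u v]] /setXP[/= uY]; rewrite inE => vB ->; rewrite /g /=.
  rewrite inE; apply/forallP=> x; rewrite permM (presB v) // (presY u) // eqxx /=.
  apply/implyP=> fJ.
  rewrite (fixY u x uY) ?inE ?(negPf fJ) ?andbF // (fixB v x vB) //.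
  by apply: contraNneq fJ => ->.
move=> [u v] [u' v'] /setXP[/= uY]; rewrite inE => vB /setXP[/= uY'].
rewrite inE /g => vB' /= E.
(* On [B] the first factors are the identity, so the product determines the second ones. *)
have Ev : v = v'.
  apply/permP=> x; have [fx|nfx] := eqVneq (f x) i; last by rewrite !fixB.
  have := congr1 (fun s : {perm T} => s x) E.
  have xJ : f x \notin J :\ i by rewrite fx !inE eqxx.
  by rewrite !permM (fixY u) // (fixY u').
by move: E; rewrite Ev => /mulIg ->.
Qed.

(** Suppose all points below [i] are fixed and [i] is not. The preimage of [i] then lies above [i]
    and in its fibre, so [z i < i]. Thus [z i] is a fixed point, and injectivity gives [z i = i]. *)
Lemma increasing_fibre_perm1 (n : nat) (I : eqType) (f : 'I_n -> I) (z : 'S_n) :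
  (forall x, f (z x) = f x) ->
  (forall i j : 'I_n, i < j -> f i = f j -> z i < z j) -> z = 1%g.
Proof.
move=> fz incz.
suff H m (i : 'I_n) : i < m -> z i = i.
  by apply/permP=> i; rewrite perm1 (H i.+1).
elim: m i => // m IHm i; rewrite ltnS leq_eqVlt => /orP[/eqP im|]; last exact: IHm.
apply/eqP; apply: contraTT isT => nzi.
have lt_i j : z j = i -> i < j.
  move=> zj; rewrite ltnNge; apply/negP; rewrite leq_eqVlt => /orP[/eqP/val_inj E|lji].
    by move: nzi; rewrite -E zj E eqxx.
  have zjj : z j = j by apply: IHm; rewrite -im.
  by move: lji; rewrite -zj zjj ltnn.
have zj := permKV z i.
have ltj := lt_i _ zj.
have : z i < i by rewrite -{2}zj; apply: incz => //; rewrite -{1}zj fz.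
rewrite {1}im => /IHm /perm_inj E; by rewrite E eqxx in nzi.
Qed.

(* Every permutation factors uniquely as an increasing one composed with a
   fibre-preserving one. *)
Lemma card_fibre_increasing (n : nat) (I : eqType) (f : 'I_n -> I) :
  #|[set w : 'S_n | [forall i : 'I_n, forall j : 'I_n,
        (i < j) && (f i == f j) ==> (w i < w j)]]| *
  #|[set s : 'S_n | [forall x, f (s x) == f x]]| = n`!.
Proof.
set X := finset _; set Y := finset _.
have XP (w : 'S_n) : reflect (forall i j : 'I_n, i < j -> f i = f j -> w i < w j) (w \in X).
  rewrite inE; apply: (iffP forallP) => [H i j ij fij|H i].
    by have /forallP/(_ j)/implyP := H i; apply; rewrite ij fij eqxx.
  by apply/forallP=> j; apply/implyP=> /andP[ij /eqP]; apply: H.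
have YP (s : 'S_n) : reflect (forall x, f (s x) = f x) (s \in Y).
  by rewrite inE; apply: (iffP forallP) => H x; apply/eqP.
pose g (u : 'S_n * 'S_n) := (u.2 * u.1)%g.
rewrite -cardsX -(card_in_imset (f := g)).
  transitivity #|[set: 'S_n]|; last by rewrite cardsT card_Sn.
  apply: eq_card => w.
  rewrite [in RHS]inE; apply/imsetP.
  (* If [y] maximizes [F], an inversion of [w \o y] inside a fibre could be
     swapped to increase [F]. *)
  pose F (y : 'S_n) := \sum_(i < n) i * w (y i).
  have Y1 : 1%g \in Y by apply/YP=> x; rewrite perm1.
  case: (arg_maxnP F Y1) => y /YP yY ymax.
  exists ((y * w)%g, y^-1%g); last by rewrite /g /= mulKg.
  apply/setXP; split=> /=; last by apply/YP=> x; rewrite -{2}(permKV y x) yY.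
  apply/XP=> i j ij fij; rewrite !permM ltn_neqAle; apply/andP; split.
    by apply: contraTneq ij => /val_inj/perm_inj/perm_inj->; rewrite ltnn.
  rewrite leqNgt; apply/negP=> lt_w.
  have /ymax : (tperm i j * y)%g \in Y.
    apply/YP=> x; rewrite permM yY.
    by case: tpermP => // ->.
  have nji : j != i by apply: contraTneq ij => ->; rewrite ltnn.
  have FE s : F s = i * w (s i) + j * w (s j) +
      \sum_(k < n | (k != i) && (k != j)) k * w (s k).
    by rewrite /F (bigD1 i) //= (bigD1 j) //= addnA.
  rewrite !FE.
  rewrite !permM tpermL tpermR.
  have -> : \sum_(k < n | (k != i) && (k != j)) k * w ((tperm i j * y)%g k) =
            \sum_(k < n | (k != i) && (k != j)) k * w (y k).
    by apply: eq_bigr => k /andP[ki kj]; rewrite permM tpermD // eq_sym.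
  rewrite /geq /= leq_add2r.
  (* The swap gains the product of the positive numbers [j - i] and [w (y i) - w (y j)]. *)
  suff: i * w (y i) + j * w (y j) < i * w (y j) + j * w (y i) by rewrite ltnNge => /negbTE->.
  move: (ltn_ord (w (y i))) lt_w ij; set a := val (w (y i)); set b := val (w (y j)).
  rewrite -/(nat_of_ord _) /=; nia.
move=> [x y] [x' y'] /setXP[/= xX yY] /setXP[/= xX' yY']; rewrite /g /= => E.
have Ex : x = (y^-1 * y' * x')%g by rewrite -mulgA -E mulKg.
(* The quotient [y^-1 * y'] preserves fibres. If it reversed a pair inside a fibre, so would [x],
   because [x'] increases on fibres; hence it is increasing there and trivial. *)
suff E1 : (y^-1 * y' = 1)%g.
  by move: Ex; rewrite E1 mul1g => ->; congr pair; apply/(mulgI y^-1%g); rewrite E1 mulVg.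
have zY u : f ((y^-1 * y')%g u) = f u.
  by rewrite permM (YP _ yY') -{2}(permKV y u) (YP _ yY).
apply: (increasing_fibre_perm1 zY) => i j ij fij.
rewrite ltnNge; apply/negP; rewrite leq_eqVlt => /orP[/eqP/val_inj/perm_inj E1|].
  by rewrite E1 ltnn in ij.
move/(XP _ xX'); rewrite !zY fij => /(_ erefl); rewrite -!(permM _ x') -Ex => lt1.
by have := XP _ xX _ _ ij fij; rewrite ltnNge (ltnW lt1).
Qed.

(** * Blocks of a composition and descents *)

Lemma reshape_index_cons x (s : seq nat) i :
  reshape_index (x :: s) i = if i < x then 0 else (reshape_index s (i - x)).+1.
Proof. by rewrite /reshape_index /= subn_eq0; case: ltnP => // le; rewrite subSn. Qed.

Lemma leq_reshape_index (s : seq nat) : {homo reshape_index s : i j / i <= j}.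
Proof.
elim: s => [|x s IHs] i j ij //; rewrite !reshape_index_cons.
case: (ltnP i x) => // xi; case: (ltnP j x) => [|_]; first by lia.
by rewrite ltnS IHs // leq_sub2r.
Qed.

(** [reshape_index b i] is the block of [b] containing position [i], and [reshape_offset b i] the
    place inside it. Partial sums are block starts, and positivity of the parts keeps every block
    nonempty. *)
Lemma mem_psums (b : seq nat) i : all (leq 1) b -> 0 < i < sumn b ->
  (i \in psums b) = (reshape_offset b i == 0).
Proof.
move=> b0 /andP[i0 ib]; have iK := reshape_indexK b i.
have ltr := reshape_indexP ib; have lto := reshape_offsetP ib.
apply/mapP/eqP => [[m] | o0].
  rewrite mem_iota => /andP[m0 ltm] ->.
  have bm : 0 < nth 0 b m.
    apply: (allP b0); apply: mem_nth; apply: leq_trans ltm _.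
    by rewrite add1n prednK // (leq_trans _ ltr).
  by have := flatten_indexKr bm; rewrite /flatten_index addn0.
exists (reshape_index b i); last by rewrite -{1}iK o0 /flatten_index addn0.
rewrite mem_iota; apply/andP; split; last by lia.
by case: posnP iK => // ->; rewrite o0 /flatten_index take0 /=; lia.
Qed.

Lemma reshape_index_pred (b : seq nat) i : all (leq 1) b -> 0 < i < sumn b ->
  (reshape_index b i.-1 == reshape_index b i) = (i \notin psums b).
Proof.
move=> b0 ib; rewrite mem_psums //; move: ib => /andP[i0 ib].
have iK := reshape_indexK b i.
have iK' := reshape_indexK b i.-1.
have lto := reshape_offsetP ib.
apply/eqP/idP => [E|o0].
  by apply: contraL isT => /eqP o0; move: iK iK'; rewrite E o0 /flatten_index; lia.
have -> : i.-1 = flatten_index b (reshape_index b i) (reshape_offset b i).-1.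
  by rewrite -{1}iK /flatten_index; lia.
by rewrite flatten_indexKl //; lia.
Qed.

Lemma card_reshape_index (b : seq nat) m :
  #|[set x : 'I_(sumn b) | reshape_index b x == m]| = nth 0 b m.
Proof.
pose g (c : 'I_(nth 0 b m)) : 'I_(sumn b) := Ordinal (flatten_indexP (ltn_ord c)).
have gI : injective g.
  move=> c d /(congr1 val) /=; rewrite /flatten_index => /addnI E; exact: val_inj.
rewrite -[RHS]card_ord -cardsT -(card_imset _ gI); apply: eq_card => x.
rewrite inE; apply/eqP/imsetP => [E|[c _ ->]]; last exact: flatten_indexKl.
have lto := reshape_offsetP (ltn_ord x); have xK := reshape_indexK b x.
rewrite E in lto xK.
by exists (Ordinal lto) => //; apply: val_inj; rewrite /= xK.
Qed.

Lemma wval_ord n (w : 'S_n) (i : 'I_n) : wval w i = w i.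
Proof. by rewrite /wval valK. Qed.

(** Comparing neighbours suffices: a block without descents at adjacent positions is increasing, by
    induction on the larger position. *)
Lemma desc_perm_subset n (b : seq nat) (w : 'S_n) : is_comp n b ->
  (desc_perm w \subset desc_comp n b) =
  [forall i : 'I_n, forall j : 'I_n,
    (i < j) && (reshape_index b i == reshape_index b j) ==> (w i < w j)].
Proof.
case/andP=> b0 /eqP bn; apply/subsetP/forallP => [sub i|H x]; last first.
  rewrite !inE => /andP[x0 dx]; apply: contraLR dx => xb.
  have x'n : x.-1 < n by have := ltn_ord x; lia.
  have /forallP/(_ x) := H (Ordinal x'n); rewrite /= reshape_index_pred ?bn ?x0 ?ltn_ord //.
  rewrite xb andbT prednK // leqnn /= => lt.
  by rewrite wval_ord -[x.-1]/(val (Ordinal x'n)) wval_ord -leqNgt ltnW.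
apply/forallP=> j; apply/implyP=> /andP[].
case: j => j ltj /=; elim: j ltj => // j IHj ltj; rewrite ltnS => ij /eqP E.
have ltj' := ltnW ltj.
(* Block indices are monotone, and [j] lies between two positions of one block. *)
have E' : reshape_index b j = reshape_index b i.
  apply/eqP; rewrite eqn_leq (leq_reshape_index _ ij) andbT E.
  exact: leq_reshape_index.
have jj : w (Ordinal ltj') < w (Ordinal ltj).
  have : Ordinal ltj \notin desc_perm w.
    apply/negP=> /sub; apply/negP; rewrite inE /= -(reshape_index_pred b0) ?bn ?ltj //=.
    by rewrite E' E.
  rewrite inE /= -[X in wval w X < _]/(val (Ordinal ltj)) wval_ord.
  rewrite -[X in _ < wval w X]/(val (Ordinal ltj')) wval_ord -leqNgt leq_eqVlt.
  by case/orP=> // /eqP/val_inj/perm_inj/(congr1 val) /= /eqP; rewrite ltn_eqF.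
move: ij; rewrite leq_eqVlt => /orP[/eqP ij|ij].
  by move: jj; congr (w _ < _); apply: val_inj.
by apply: ltn_trans jj; apply: IHj => //; rewrite E'.
Qed.

(** These permutations are those increasing on the blocks, and the product is the order of the Young
    subgroup preserving the blocks. *)
Lemma card_desc_perm_subset n (b : seq nat) : is_comp n b ->
  #|[set w : 'S_n | desc_perm w \subset desc_comp n b]| * \prod_(x <- b) x`! = n`!.
Proof.
move=> bn; have /andP[b0 /eqP En] := bn; subst n.
pose f (x : 'I_(sumn b)) : 'I_(size b) := Ordinal (reshape_indexP (ltn_ord x)).
rewrite -(card_fibre_increasing f); congr (_ * _).
  apply: eq_card => w; rewrite !inE (desc_perm_subset _ bn).
  by apply: eq_forallb => i; apply: eq_forallb => j.
(* With [J] the full index set, no point is forced to be fixed. *)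
transitivity (\prod_(i in [set: 'I_(size b)]) #|[set x | f x == i]|`!).
  rewrite (big_nth 0) big_mkord; apply: eq_big => [i|i _]; first by rewrite inE.
  by rewrite -card_reshape_index; congr (_`!); apply: eq_card => x; rewrite !inE.
rewrite -card_fibre_perms; apply: eq_card => s; rewrite !inE.
by apply: eq_forallb => x; rewrite inE andbT.
Qed.

Lemma multinom_card n (b : seq nat) : is_comp n b ->
  multinom n b = #|[set w : 'S_n | desc_perm w \subset desc_comp n b]|.
Proof.
move=> bn; have /andP[_ sb] := bn; rewrite /multinom sb.
by rewrite -(card_desc_perm_subset bn) mulnK // prodn_gt0 // => x; apply: fact_gt0.
Qed.

(** * Multinomials, base-p digits and Lucas's theorem *)

Lemma dvdn_prod_fact (s : seq nat) : \prod_(x <- s) x`! %| (sumn s)`!.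
Proof.
elim: s => [|x s IHs]; first by rewrite big_nil.
rewrite big_cons /= -(@bin_fact (x + sumn s) x) ?leq_addr // addKn.
by rewrite mulnA dvdn_mul // dvdn_mull.
Qed.

Lemma multinom_nil m : multinom m [::] = (m == 0).
Proof. by rewrite /multinom /= big_nil eq_sym; case: eqP => // ->. Qed.

(** If [x > m] both sides vanish, the right one through its binomial, so the truncation in [m - x]
    does no harm. *)
Lemma multinom_cons m x s : multinom m (x :: s) = 'C(m, x) * multinom (m - x) s.
Proof.
rewrite /multinom /=; have [lemx|ltmx] := leqP x m; last first.
  by rewrite bin_small // mul0n ifF //; apply/eqP; lia.
have -> : (x + sumn s == m) = (sumn s == m - x) by lia.
case: eqP => [E|]; last by rewrite muln0.
have p0 : 0 < \prod_(j <- s) j`! by rewrite prodn_gt0 // => j; apply: fact_gt0.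
rewrite big_cons -(bin_fact lemx) -E.
by rewrite mulnCA divnMl ?fact_gt0 // muln_divA ?dvdn_prod_fact.
Qed.

Lemma digit_lt p j m : 0 < p -> digit p j m < p.
Proof. by move=> p0; rewrite /digit ltn_mod. Qed.

Lemma digitS p j m : digit p j.+1 m = digit p j (m %/ p).
Proof. by rewrite /digit expnS divnMA. Qed.

Lemma digit0 p m : digit p 0 m = m %% p.
Proof. by rewrite /digit expn0 divn1. Qed.

Lemma sum_digit p K m : m < p ^ K -> \sum_(j < K) digit p j m * p ^ j = m.
Proof.
elim: K m => [|K IHK] m ltm.
  by rewrite big_ord0; move: ltm; rewrite expn0; lia.
have p0 : 0 < p by rewrite lt0n; apply: contraTneq ltm => ->; rewrite exp0n.
rewrite big_ord_recl digit0 muln1.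
rewrite (eq_bigr (fun j : 'I_K => p * (digit p j (m %/ p) * p ^ j))); last first.
  by move=> j _; rewrite digitS expnS mulnCA.
rewrite -big_distrr /= IHK ?ltn_divLR -?expnSr // [RHS](divn_eq m p); lia.
Qed.

Section Lucas.
Variable p : nat.
Hypothesis p_pr : prime p.

Local Open Scope ring_scope.

Lemma coef_1DX_exp (R : comNzRingType) m k : ((1 + 'X : {poly R}) ^+ m)`_k = ('C(m, k))%:R.
Proof.
rewrite exprDn coef_sum (eq_bigr (fun i : 'I_m.+1 => (k == i)%:R * ('C(m, i))%:R)); last first.
  by move=> i _; rewrite expr1n mul1r coefMn coefXn mulr_natr.
have [ltkm|lemk] := ltnP k m.+1.
  rewrite (bigD1 (Ordinal ltkm)) //= eqxx mul1r big1 ?addr0 // => i ni.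
  case: eqP => [E|]; last by rewrite mul0r.
  by case/eqP: ni; apply: val_inj.
rewrite bin_small // big1 // => i _; rewrite gtn_eqF ?mul0r //.
exact: leq_trans (ltn_ord i) lemk.
Qed.

(** Compare coefficients in [(1 + X)^(ap + c) = (1 + X^p)^a (1 + X)^c] over ['F_p]: as [c] and [d]
    are below [p], only the term in [X^(pb)] of the first factor contributes. *)
Lemma bin_mod_Fp a b c d : (c < p)%N -> (d < p)%N ->
  ('C(a * p + c, b * p + d))%:R = ('C(a, b))%:R * ('C(c, d))%:R :> 'F_p.
Proof.
move=> cp dp; rewrite -coef_1DX_exp exprD mulnC exprM.
have -> : (1 + 'X : {poly 'F_p}) ^+ p = 1 + 'X^p.
  have ch : p \in [pchar {poly 'F_p}] by rewrite pchar_poly; exact: pchar_Fp.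
  by rewrite -!(pFrobenius_autE ch) rmorphD rmorph1.
rewrite exprDn mulr_suml coef_sum.
rewrite (eq_bigr (fun i : 'I_a.+1 =>
  (i == b :> nat)%:R * (('C(a, b))%:R * ('C(c, d))%:R))); last first.
  move=> i _; rewrite expr1n mul1r -exprM [in LHS]mulrnAl coefMn coefXnM coef_1DX_exp.
  case: ltnP => [lt|ge].
    rewrite mul0rn gtn_eqF ?mul0r //; nia.
  case: eqP => [->|ne].
    have -> : (b * p + d - p * b = d)%N by lia.
    by rewrite mul1r [RHS]mulr_natl.
  by rewrite mul0r bin_small ?mul0rn //; nia.
rewrite -mulr_suml.
have [ltba|leab] := ltnP b a.+1.
  rewrite (bigD1 (Ordinal ltba)) //= eqxx big1 ?addr0 ?mul1r // => i ni.
  case: eqP => // E; by case/eqP: ni; apply: val_inj.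
by rewrite [('C(a, b))%N]bin_small // mul0r mulr0.
Qed.

(** Lucas's theorem, by splitting off the lowest digit with [bin_mod_Fp]. *)
Lemma Lucas_Fp K m x : (m < p ^ K)%N -> (x < p ^ K)%N ->
  ('C(m, x))%:R = (\prod_(j < K) 'C(digit p j m, digit p j x))%:R :> 'F_p.
Proof.
have p0 := prime_gt0 p_pr.
elim: K m x => [|K IHK] m x.
  by rewrite expn0 !ltnS !leqn0 => /eqP-> /eqP->; rewrite big_ord0.
move=> ltm ltx; rewrite big_ord_recl !digit0 {1}(divn_eq m p) {1}(divn_eq x p).
rewrite bin_mod_Fp ?ltn_mod // natrM mulrC; congr (_ * _).
rewrite IHK ?ltn_divLR -?expnSr //; congr (_%:R).
by apply: eq_bigr => j _; rewrite /= /bump /= add1n !digitS.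
Qed.

End Lucas.

Lemma digit_sum p K (b : 'I_K -> nat) (j : 'I_K) : (forall i, b i < p) ->
  digit p j (\sum_(i < K) b i * p ^ i) = b j.
Proof.
elim: K b j => [|K IHK] b j bp; first by case: j.
have p0 : 0 < p by apply: leq_ltn_trans (bp j).
rewrite big_ord_recl muln1.
rewrite (eq_bigr (fun i : 'I_K => b (lift ord0 i) * p ^ i * p)); last first.
  by move=> i _; rewrite /= /bump /= add1n expnSr mulnA.
rewrite -big_distrl /= addnC; case: (unliftP ord0 j) => [i ->|->].
  rewrite /= /bump /= add1n digitS divnMDl // divn_small // addn0.
  exact: (IHK (fun i => b (lift ord0 i)) i (fun i => bp _)).
by rewrite digit0 modnMDl modn_small.
Qed.

(** No borrow occurs: the digitwise differences are below [p], so they are the digits of [m - x]. *)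
Lemma digit_sub p K m x : m < p ^ K -> x < p ^ K ->
  (forall j : 'I_K, digit p j x <= digit p j m) ->
  forall j : 'I_K, digit p j (m - x) = digit p j m - digit p j x.
Proof.
move=> mK xK le j.
have p0 : 0 < p.
  by rewrite lt0n; apply: contraTneq mK => ->; case: K j {xK le} => [[]//|K _]; rewrite exp0n.
rewrite -{1}(sum_digit mK) -{1}(sum_digit xK) -sumnB; last first.
  by move=> i _; rewrite leq_mul2r le orbT.
under eq_bigr do rewrite -mulnBl.
rewrite (digit_sum (b := fun i : 'I_K => digit p i m - digit p i x)) // => i.
by rewrite (leq_ltn_trans (leq_subr _ _)) // digit_lt.
Qed.

Lemma sumn_digit p K (s : seq nat) : all (fun x => x < p ^ K) s ->
  sumn s = \sum_(j < K) sumn [seq digit p j x | x <- s] * p ^ j.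
Proof.
elim: s => [|x s IHs] /=; first by rewrite big1 // => j; rewrite mul0n.
case/andP=> xK /IHs ->; rewrite -{1}(sum_digit xK) -big_split /=.
by apply: eq_bigr => j _; rewrite mulnDl.
Qed.

(** [multinom_cons] peels off one binomial per part on both sides, and Lucas's theorem matches
    them. *)
Lemma multinom_Lucas p K m (s : seq nat) : prime p -> m < p ^ K ->
  all (fun x => x < p ^ K) s ->
  ((multinom m s)%:R = (\prod_(j < K) multinom (digit p j m) [seq digit p j x | x <- s])%:R
    :> 'F_p)%R.
Proof.
move=> p_pr; have p0 := prime_gt0 p_pr; elim: s m => [|x s IHs] m mK /=.
  rewrite multinom_nil => _; congr (_%:R)%R.
  under eq_bigr do rewrite multinom_nil.
  have [->|m0] := posnP m.
    by rewrite big1 // => j _; rewrite /digit div0n mod0n.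
  (* A positive [m] has a nonzero digit, whose factor kills the right side as well. *)
  suff /existsP[j nz] : [exists j : 'I_K, digit p j m != 0].
    by rewrite (bigD1 j) //= (negbTE nz) mul0n.
  apply: contraTT m0 => /existsPn z; rewrite -(sum_digit mK) big1 // => j _.
  by have := z j; rewrite negbK => /eqP->.
case/andP=> xK sK; rewrite multinom_cons natrM (Lucas_Fp p_pr mK xK) -natrM.
under [in RHS]eq_bigr do rewrite multinom_cons.
rewrite big_split /=.
have [/forallP le|/forallPn[j]] := boolP [forall j : 'I_K, digit p j x <= digit p j m].
  rewrite !natrM IHs ?(leq_ltn_trans (leq_subr _ _)) //; congr (_ * _%:R)%R.
  by apply: eq_bigr => j _; rewrite (digit_sub mK xK le).
(* A digit of [x] exceeding that of [m] gives a zero binomial on both sides. *)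
by rewrite -ltnNge => lt; rewrite (bigD1 j) //= bin_small // mul0n muln0.
Qed.

(** * The set P and carry-free sums *)

Section DigitSets.
Variables (p n : nat).
Hypotheses (p_pr : prime p) (n0 : 0 < n).
Local Notation K := (kdeg p n).+1.

Lemma ltn_kdeg : n < p ^ K.
Proof. by apply: trunc_log_ltn; apply: prime_gt1. Qed.

(** Digits are unique, so the only possible [b] is the digit sequence of [x]. *)
Lemma mem_Pset (x : 'I_n) :
  (x \in Pset p n) = (0 < x) && [forall j : 'I_K, digit p j x <= digit p j n].
Proof.
have xK : x < p ^ K := ltn_trans (ltn_ord x) ltn_kdeg.
rewrite inE; congr (_ && _); apply/existsP/forallP => [[b /andP[/forallP bn /eqP E]] j|H].
  rewrite [val x]E (digit_sum (b := fun j => nat_of_ord (b j))) => [|k]; [exact: bn|exact: ltn_ord].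
exists [ffun j : 'I_K => Ordinal (digit_lt j x (prime_gt0 p_pr))].
apply/andP; split; first by apply/forallP=> j; rewrite ffunE; apply: H.
by apply/eqP; rewrite -[LHS](sum_digit xK); apply: eq_bigr => j _; rewrite ffunE.
Qed.

Lemma card_leq_ord c : c < p -> #|[pred v : 'I_p | v <= c]| = c.+1.
Proof.
move=> cp; rewrite -sum1_card /=.
rewrite -[RHS]card_ord -[RHS]sum1_card.
exact: (big_ord_narrow (F := fun=> 1) cp).
Qed.

(** The vectors bounded by the digits of [n] represent distinct numbers: the elements of [Pset], and
    also 0 and [n], which account for the 2. *)
Lemma card_Pset : (#|Pset p n|).+2 = prodP p n.
Proof.
pose F (j : 'I_K) := [pred v : 'I_p | v <= digit p j n].
have <- : #|family F| = prodP p n.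
  rewrite card_family /prodP foldrE big_image /=; apply: eq_bigr => j _.
  by rewrite card_leq_ord // digit_lt // prime_gt0.
(* The target is ['I_n.+1] because [n] itself is represented; on the family [F] the sum is at most
   [n], so [inord] keeps it. *)
pose g (b : {ffun 'I_K -> 'I_p}) : 'I_n.+1 := inord (\sum_(j < K) b j * p ^ j).
have gE b : b \in family F -> g b = \sum_(j < K) b j * p ^ j :> nat.
  move/familyP=> bF; rewrite inordK // ltnS -[leqRHS](sum_digit ltn_kdeg).
  by apply: leq_sum => j _; rewrite leq_mul2r; apply/orP; right; apply: bF.
have gI : {in family F &, injective g}.
  move=> b c bF cF /(congr1 val) /=; rewrite !gE // => E; apply/ffunP=> j; apply: val_inj.
  rewrite /= -(@digit_sum p K (fun j => nat_of_ord (b j)) j) // E.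
  by rewrite (digit_sum (b := fun j => nat_of_ord (c j))).
rewrite -(card_in_imset gI).
pose D := [set widen_ord (leqnSn n) x | x in Pset p n].
have wI : injective (widen_ord (leqnSn n)) by move=> x y /(congr1 val) /= /val_inj.
have -> : [set g b | b in family F] = ord0 |: (ord_max |: D).
  apply/setP=> x; rewrite !inE; apply/imsetP/idP => [[b bF ->]|].
    have le (j : 'I_K) : digit p j (g b) <= digit p j n.
      rewrite gE // (digit_sum (b := fun j => nat_of_ord (b j))) //.
      by move/familyP: bF; apply.
    have [//|g0] := eqVneq (g b) ord0; have [//|gn] := eqVneq (g b) ord_max.
    have ltgn : g b < n by have := ltn_ord (g b); rewrite -val_eqE /= in gn; lia.
    apply/imsetP; exists (Ordinal ltgn); last exact: val_inj.
    by rewrite mem_Pset /= lt0n; apply/andP; split => //; apply/forallP.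
  have H (y : 'I_n.+1) : (forall j : 'I_K, digit p j y <= digit p j n) ->
      exists2 b, b \in family F & y = g b.
    move=> le; have yK : y < p ^ K := leq_ltn_trans (leq_ord y) ltn_kdeg.
    pose b := [ffun j : 'I_K => Ordinal (digit_lt j y (prime_gt0 p_pr))].
    have bF : b \in family F by apply/familyP=> j; rewrite inE ffunE; apply: le.
    exists b => //; apply: val_inj; rewrite /= gE // -[LHS](sum_digit yK).
    by apply: eq_bigr => j _; rewrite ffunE.
  case/or3P => [/eqP->|/eqP->|/imsetP[y yP ->]]; apply: H => j //.
    by rewrite /digit div0n mod0n.
  by move: yP; rewrite mem_Pset => /andP[_ /forallP].
have D0 : ord0 \notin D.
  by apply/imsetP=> [[y]]; rewrite mem_Pset => /andP[y0 _] /(congr1 val) /=; lia.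
have Dn : ord_max \notin D.
  by apply/imsetP=> [[y _]] /(congr1 val) /=; have := ltn_ord y; lia.
have nn : (ord0 == ord_max :> 'I_n.+1) = false.
  by rewrite -val_eqE /= eq_sym gtn_eqF.
by rewrite !cardsU1 !inE nn (negbTE D0) Dn card_imset.
Qed.

(** If the digits of the parts summed to those of [n] at every place, the digit sums of an initial
    segment would be below [p], hence be the digits of its partial sum, putting that sum in P. So at
    some place they do not, and Lucas's theorem has a zero factor there. *)
Lemma multinom_Fp_eq0 (b : seq nat) : is_comp n b -> ~~ (desc_comp n b \subset Pset p n) ->
  ((multinom n b)%:R = 0 :> 'F_p)%R.
Proof.
case/andP=> b0 /eqP sb; case/subsetPn => i; rewrite inE => /mapP[m].
rewrite mem_iota => /andP[m0 mb] Ei.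
have p0 := prime_gt0 p_pr.
have bK : all (fun x => x < p ^ K) b.
  apply/allP=> x xb; apply: leq_ltn_trans ltn_kdeg; rewrite -sb.
  by rewrite (perm_sumn (perm_to_rem xb)) /= leq_addr.
have i0 : 0 < i.
  rewrite [val i]Ei; case: (b) b0 m0 mb => [|x s] /= ; first by case: (m).
  by case: (m) => //= m' /andP[x0 _] _ _; rewrite addn_gt0 x0.
rewrite mem_Pset i0 /= => /forallPn[j nle].
rewrite (multinom_Lucas p_pr ltn_kdeg bK).
suff [k nk] : exists k : 'I_K, sumn [seq digit p k x | x <- b] != digit p k n.
  by rewrite (bigD1 k) //= {1}/multinom (negbTE nk).
apply/existsP; apply: contraNT nle => /existsPn H.
have eqd (k : 'I_K) : sumn [seq digit p k x | x <- b] = digit p k n.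
  by apply/eqP; have := H k; rewrite negbK.
have tb : all (fun x => x < p ^ K) (take m b).
  by move: bK; rewrite -{1}(cat_take_drop m b) all_cat => /andP[].
have le (k : 'I_K) : sumn [seq digit p k x | x <- take m b] <= digit p k n.
  by rewrite -eqd -{2}(cat_take_drop m b) map_cat sumn_cat leq_addr.
rewrite [val i]Ei (sumn_digit tb).
rewrite (digit_sum (b := fun k : 'I_K => sumn [seq digit p k x | x <- take m b])) //.
by move=> k; apply: leq_ltn_trans (le k) _; apply: digit_lt.
Qed.

End DigitSets.

(** * Compositions of n as subsets of [n-1] *)

Lemma foldl_addn x (s : seq nat) : foldl addn x s = x + sumn s.
Proof. by elim: s x => [|y s IHs] x /=; rewrite ?addn0 // IHs addnA. Qed.

(** [psums] leaves out the total. Once it is appended, the list is a running sum, which taking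
    differences inverts. *)
Lemma rcons_psums (b : seq nat) : b != [::] ->
  rcons (psums b) (sumn b) = scanl addn 0 b.
Proof.
move=> b0; have sb : 0 < size b by rewrite lt0n size_eq0.
apply: (@eq_from_nth _ 0) => [|i]; rewrite size_rcons size_map size_iota prednK //.
  by rewrite size_scanl.
move=> ib; rewrite (nth_scanl _ _ ib) foldl_addn add0n nth_rcons size_map size_iota.
case: ltnP => [lti|gei].
  by rewrite (nth_map 0) ?size_iota // nth_iota // add1n.
have -> : i = (size b).-1 by lia.
by rewrite eqxx prednK // take_size.
Qed.

Lemma path_scanl_addn x (b : seq nat) : all (leq 1) b -> path ltn x (scanl addn x b).
Proof.
elim: b x => //= y b IHb x /andP[y0 b0].
by rewrite IHb // andbT -[ltnLHS]addn0 ltn_add2l.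
Qed.

Lemma pairmap_subnK x (s : seq nat) : path leq x s ->
  scanl addn x (pairmap (fun u v => v - u) x s) = s.
Proof.
by elim: s x => //= y s IHs x /andP[xy ps]; rewrite subnKC // IHs.
Qed.

Lemma pairmap_subn_gt0 x (s : seq nat) : path ltn x s ->
  all (leq 1) (pairmap (fun u v => v - u) x s).
Proof. by elim: s x => //= y s IHs x /andP[xy /IHs->]; rewrite subn_gt0 xy. Qed.

Section Compositions.
Variable n : nat.
Hypothesis n0 : 0 < n.

(* [[n-1]], as a subset of 'I_n. *)
Definition posI : {set 'I_n} := [set x : 'I_n | 0 < x].

(** On subsets of [n-1] this is the inverse of [desc_comp]. *)
Definition comp_of (S : {set 'I_n}) : seq nat :=
  pairmap (fun u v => v - u) 0 (rcons [seq val x | x <- enum S] n).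

Lemma sorted_enum_set (S : {set 'I_n}) : sorted ltn [seq val x | x <- enum S].
Proof.
have -> : enum S = [seq x <- enum 'I_n | x \in S] by rewrite enumT.
rewrite sorted_map; apply: sorted_filter; first by move=> x y z; apply: ltn_trans.
by rewrite -sorted_map val_enum_ord iota_ltn_sorted.
Qed.

Lemma path_comp_of (S : {set 'I_n}) : S \subset posI ->
  path ltn 0 (rcons [seq val x | x <- enum S] n).
Proof.
move=> /subsetP S0; rewrite rcons_path path_min_sorted ?sorted_enum_set //; last first.
  apply/allP=> _ /mapP[x xS ->]; rewrite mem_enum in xS.
  by have := S0 _ xS; rewrite inE.
have := mem_last 0 [seq val x | x <- enum S]; rewrite inE.
by case/orP => [/eqP-> //|/mapP[x _ ->]]; apply: ltn_ord.
Qed.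

(** Running sums recover [S] followed by [n]. The size bound, which holds because [S] misses 0,
    places the composition in the range of [l] in [cpi] and [rT]. *)
Lemma comp_ofE (S : {set 'I_n}) : S \subset posI ->
  [/\ is_comp n (comp_of S), desc_comp n (comp_of S) = S & size (comp_of S) < n.+1].
Proof.
move=> S0; have pS := path_comp_of S0.
have cS : scanl addn 0 (comp_of S) = rcons [seq val x | x <- enum S] n.
  by apply: pairmap_subnK; apply: sub_path pS => x y; apply: ltnW.
have szc : size (comp_of S) = #|S|.+1.
  by rewrite size_pairmap size_rcons size_map -cardE.
have nz : comp_of S != [::] by rewrite -size_eq0 szc.
have := rcons_psums nz; rewrite cS => /rcons_inj[Ep Es]; split.
- by rewrite /is_comp Es eqxx andbT; apply: pairmap_subn_gt0.
- by apply/setP=> x; rewrite inE Ep mem_map ?mem_enum //; apply: val_inj.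
rewrite szc ltnS -[X in _ < X]card_ord -cardsT; apply: proper_card.
rewrite properEneq subsetT andbT; apply: contraTneq S0 => ->.
by apply/subsetPn; exists (Ordinal n0); rewrite ?inE.
Qed.

(** A strictly increasing list is determined by its members, so [psums b] is the enumeration of
    [desc_comp n b]. *)
Lemma comp_of_desc_comp (b : seq nat) : is_comp n b -> comp_of (desc_comp n b) = b.
Proof.
case/andP=> b0 /eqP sb.
have nz : b != [::] by apply: contraTneq n0 => bn; rewrite -sb bn.
have pb := path_scanl_addn 0 b0; have rb := rcons_psums nz.
rewrite /comp_of -[RHS](@scanlK _ _ (fun u v => v - u) addn _ 0); last first.
  by move=> x y /=; rewrite addKn.
rewrite -rb sb; congr (pairmap _ _ (rcons _ _)).
rewrite -rb rcons_path in pb; case/andP: pb => pb _.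
apply: (irr_sorted_eq ltn_trans ltnn) (sorted_enum_set _) (path_sorted pb) _ => m.
apply/mapP/idP => [[x + ->]|mb]; first by rewrite mem_enum inE.
suff mn : m < n by exists (Ordinal mn); rewrite // mem_enum inE.
have : path ltn 0 (rcons (psums b) n) by rewrite -sb rb; apply: path_scanl_addn.
rewrite (path_sortedE ltn_trans) -cats1 => /andP[_].
rewrite (sorted_pairwise ltn_trans) pairwise_cat => /and3P[/allrelP/(_ m n) H _ _].
by apply: H => //; rewrite inE.
Qed.

(** Inserting an inner sum over [S], with one surviving term at the descent set, and exchanging
    leaves for each [S] only the tuple of [comp_of S]. A general monoid serves both the count [cpi]
    and the integer sum [rT]. *)
Lemma big_comp (R : Type) (idx : R) (op : Monoid.com_law idx) (F : seq nat -> R) :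
  \big[op/idx]_(l < n.+1) \big[op/idx]_(t : l.-tuple 'I_n.+1)
     (if is_comp n (map val t) then F (map val t) else idx) =
  \big[op/idx]_(S : {set 'I_n} | S \subset posI) F (comp_of S).
Proof.
have desc_pos b : is_comp n b -> desc_comp n b \subset posI.
  case/andP=> b0 /eqP sb; apply/subsetP => x; rewrite !inE => xb.
  rewrite lt0n; apply: contraTneq xb => x0; rewrite [val x]x0.
  have nz : b != [::] by apply: contraTneq n0 => bn; rewrite -sb bn.
  have := path_scanl_addn 0 b0; rewrite -rcons_psums // rcons_path => /andP[pb _].
  move: pb; rewrite (path_sortedE ltn_trans) => /andP[/allP H _].
  by apply/negP=> /H.
transitivity (\big[op/idx]_(l < n.+1) \big[op/idx]_(t : l.-tuple 'I_n.+1)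
   \big[op/idx]_(S : {set 'I_n} | S \subset posI)
     (if is_comp n (map val t) && (desc_comp n (map val t) == S)
      then F (map val t) else idx)).
  apply: eq_bigr => l _; apply: eq_bigr => t _; case: ifP => ct; last by rewrite big1.
  rewrite (bigD1 (desc_comp n (map val t))) ?desc_pos //= eqxx big1 ?Monoid.mulm1 // => S.
  by case/andP => _ nS; rewrite eq_sym (negbTE nS).
under eq_bigr do rewrite exchange_big /=.
rewrite exchange_big /=; apply: eq_bigr => S SP.
have [cS dS szS] := comp_ofE SP.
have uniq_comp b : is_comp n b && (desc_comp n b == S) -> b = comp_of S.
  by case/andP=> cb /eqP <-; rewrite comp_of_desc_comp.
rewrite (bigD1 (Ordinal szS)) //= [X in op _ X]big1 ?Monoid.mulm1; last first.
  move=> l nl; apply: big1 => t _; case: ifP => // /uniq_comp E.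
  by case/eqP: nl; apply: val_inj; rewrite /= -E size_map size_tuple.
(* Parts of a composition of [n] are at most [n], so [inord] loses nothing. *)
have tE : map val (map_tuple (fun x : nat => inord x : 'I_n.+1) (in_tuple (comp_of S))) = comp_of S.
  rewrite /= -map_comp -[RHS]map_id; apply/eq_in_map => x xS /=.
  rewrite inordK // ltnS; case/andP: cS => _ /eqP <-.
  by rewrite (perm_sumn (perm_to_rem xS)) /= leq_addr.
rewrite (bigD1 (map_tuple (fun x : nat => inord x : 'I_n.+1) (in_tuple (comp_of S)))) //=.
rewrite tE cS dS eqxx big1 ?Monoid.mulm1 // => t nt; case: ifP => // /uniq_comp E.
by case/eqP: nt; apply: val_inj; apply: (inj_map val_inj); rewrite E -[LHS]tE.
Qed.

End Compositions.

(** * Sign and parity sums over subsets *)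

(** Sets up the pairing of [A] with [x |: A], used below to cancel signs and to balance parities. *)
Lemma big_set_toggle (R : Type) (idx : R) (op : Monoid.com_law idx) (T : finType)
    (x : T) (P : pred {set T}) (F : {set T} -> R) :
  \big[op/idx]_(A : {set T} | P A) F A =
  op (\big[op/idx]_(A : {set T} | (x \notin A) && P A) F A)
     (\big[op/idx]_(A : {set T} | (x \notin A) && P (x |: A)) F (x |: A)).
Proof.
rewrite (bigID (fun A : {set T} => x \notin A)) /=; congr (op _ _).
  by apply: eq_bigl => A; rewrite andbC.
rewrite (reindex_onto (fun A => x |: A) (fun A => A :\ x)) /=; last first.
  by move=> A /andP[_]; rewrite negbK => xA; rewrite setD1K.
apply: eq_bigl => A; rewrite setU11 andbT andbC; congr (_ && _).
by apply/eqP/idP => [<-|xA]; rewrite ?setD11 // setU1K.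
Qed.

(** Toggling a point of [Q] flips parity, so each of the [2 ^ #|Q|.-1] pairs contributes both values
    of [g]. *)
Lemma sum_parity_subset (T : finType) (Q : {set T}) (g : bool -> nat) :
  Q != set0 ->
  \sum_(U : {set T} | U \subset Q) g (odd #|U|) = 2 ^ #|Q|.-1 * (g false + g true).
Proof.
case/set0Pn=> x xQ; rewrite (big_set_toggle _ x) /=.
have E1 (U : {set T}) : (x \notin U) && (U \subset Q) = (U \in powerset (Q :\ x)).
  by rewrite inE subsetD1 andbC.
have E2 (U : {set T}) : (x \notin U) && (x |: U \subset Q) = (U \in powerset (Q :\ x)).
  by rewrite inE subsetD1 subUset sub1set xQ andbC.
rewrite (eq_bigl _ _ E1) (eq_bigl _ _ E2) -big_split /=.
rewrite (eq_bigr (fun=> g false + g true)); last first.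
  move=> U; rewrite -E1 => /andP[xU _]; rewrite cardsU1 xU /=.
  by case: (odd _) => //; rewrite addnC.
by rewrite sum_nat_const card_powerset (cardsD1 x Q) xQ.
Qed.

Section RingScope.
Local Open Scope ring_scope.

(** Moebius inversion on the Boolean lattice: toggling a point of [S] outside [A] cancels the signs.
    The exponent is a sum, of the same parity as the difference, to avoid truncated subtraction. *)
Lemma sum_sign_interval (R : pzRingType) (T : finType) (A S : {set T}) :
  \sum_(B : {set T} | (A \subset B) && (B \subset S)) (-1) ^+ (#|S| + #|B|) =
  (A == S)%:R :> R.
Proof.
case: (eqVneq A S) => [<-|nAS].
  rewrite (bigD1 A) ?subxx //= big1 ?addr0; last first.
    by move=> B /andP[/andP[AB BA]]; rewrite eqEsubset AB BA.
  by rewrite addnn -mul2n exprM sqrrN expr1n expr1n.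
have [AS|nsub] := boolP (A \subset S); last first.
  by rewrite big1 // => B /andP[AB /(subset_trans AB)]; rewrite (negPf nsub).
have /subsetPn[x xS xA] : ~~ (S \subset A) by rewrite eqEsubset AS in nAS.
rewrite (big_set_toggle _ x) /=.
rewrite [X in _ + X](eq_bigr (fun B : {set T} => - (-1) ^+ (#|S| + #|B|))); last first.
  by move=> B /andP[xB _]; rewrite cardsU1 xB addnCA exprD expr1 mulN1r.
rewrite [X in _ + X](eq_bigl (fun B : {set T} => (x \notin B) && ((A \subset B) && (B \subset S)))).
  by rewrite sumrN subrr.
move=> B; case xB: (x \in B) => //=; rewrite subUset sub1set xS /=.
congr (_ && _); apply/idP/idP => [/subsetP H|H]; last exact: subset_trans (subsetUr _ _).
by apply/subsetP=> y yA; have := H y yA; rewrite !inE; case: eqP xA => // <-; rewrite yA.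
Qed.

(** * Ribbon numbers modulo p *)

Definition ribbon_set n (S : {set 'I_n}) : nat := #|[set w : 'S_n | desc_perm w == S]|.

(** Each multinomial counts the [w] with descent set inside [B]. After exchanging sums, the signs
    for a fixed [w] add up to the indicator of [desc_perm w == S]. *)
Lemma ribbon_set_sum (R : pzRingType) n (S : {set 'I_n}) : (0 < n)%N -> S \subset posI n ->
  (ribbon_set S)%:R =
  \sum_(B : {set 'I_n} | B \subset S) (-1) ^+ (#|S| + #|B|) * (multinom n (comp_of B))%:R :> R.
Proof.
move=> n0 SP.
under eq_bigr => B BS.
  have [cB dB _] := comp_ofE n0 (subset_trans BS SP).
  rewrite (multinom_card cB) dB -sum1dep_card natr_sum mulr_sumr big_mkcond /=; over.
rewrite exchange_big /= /ribbon_set -sum1dep_card natr_sum big_mkcond /=.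
apply: eq_bigr => w _; rewrite -big_mkcondr /=.
rewrite (eq_bigl (fun B : {set 'I_n} => (desc_perm w \subset B) && (B \subset S))); last first.
  by move=> B; rewrite andbC.
under eq_bigr do rewrite mulr1.
by rewrite sum_sign_interval; case: eqP.
Qed.

Section Prime.
Variables (p n : nat).
Hypotheses (p_pr : prime p) (n0 : (0 < n)%N).
Local Notation K := (kdeg p n).+1.

Lemma Pset_pos : Pset p n \subset posI n.
Proof. by apply/subsetP=> x; rewrite mem_Pset // inE => /andP[]. Qed.

Lemma rT_Fp (T : {set 'I_n}) : T \subset Pset p n ->
  (rT p T)%:~R = \sum_(B : {set 'I_n} | B \subset T)
     (-1) ^+ (#|T| + #|B|) * (multinom n (comp_of B))%:R :> 'F_p.
Proof.
move=> TP; have TN := subset_trans TP Pset_pos.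
have -> : rT p T = \sum_(S : {set 'I_n} | S \subset posI n) rT_term p T (comp_of S).
  rewrite -(big_comp n0); apply: eq_bigr => l _; apply: eq_bigr => t _.
  by rewrite /rT_term; case: (is_comp _ _).
rewrite rmorph_sum /= [RHS]big_mkcond [LHS]big_mkcond /=; apply: eq_bigr => S _.
case: ifP => [SP|nSP]; last first.
  by rewrite ifF //; apply/negP => /subset_trans/(_ TN); rewrite nSP.
have [cS dS _] := comp_ofE n0 SP; rewrite /rT_term cS dS /=.
case: (boolP (S \subset T)) => //= ST.
have bK : all (fun x => x < p ^ K)%N (comp_of S).
  apply/allP=> x xb; apply: leq_ltn_trans (ltn_kdeg n p_pr).
  by case/andP: cS => _ /eqP <-; rewrite (perm_sumn (perm_to_rem xb)) /= leq_addr.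
rewrite (multinom_Lucas p_pr (ltn_kdeg n p_pr) bK).
have sgn : ((-1) ^+ (#|T| + #|S|) : 'F_p) = (-1) ^+ (#|T| - #|S|).
  by rewrite -signr_odd oddD -oddB ?signr_odd // subset_leq_card.
case: ifP => [_|/negbT/forallPn[j nj]].
  by rewrite rmorphM /= rmorphXn /= rmorphN1 sgn.
by rewrite (bigD1 j) //= {1}/multinom (negPf nj) mul0n mulr0.
Qed.

(** Terms with [B] not inside P vanish, leaving the sum for [S :&: Pset p n]; the points of [S]
    outside P only change the sign. *)
Lemma ribbon_set_Fp (S : {set 'I_n}) : S \subset posI n ->
  (ribbon_set S)%:R = (-1) ^+ odd #|S :\: Pset p n| * (rT p (S :&: Pset p n))%:~R :> 'F_p.
Proof.
move=> SN; rewrite (ribbon_set_sum _ n0 SN) rT_Fp ?subsetIr // mulr_sumr.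
rewrite (bigID (fun B : {set 'I_n} => B \subset Pset p n)) /= [X in _ + X]big1 ?addr0.
  apply: eq_big => [B|B _]; first by rewrite subsetI.
  rewrite mulrA signr_odd -exprD -(cardsID (Pset p n) S).
  by rewrite [(#|_ :\: _| + _)%N]addnCA addnA.
move=> B /andP[BS nBP].
have [cB dB _] := comp_ofE n0 (subset_trans BS SN).
by rewrite (multinom_Fp_eq0 p_pr cB) ?mulr0 // dB.
Qed.

Lemma eq_natr_Fp (a b : nat) : (a%:R == b%:R :> 'F_p) = (a %% p == b %% p)%N.
Proof. by rewrite -val_eqE /= !val_Fp_nat. Qed.

Lemma eq_intr_Fp (z : int) (i : nat) : (i < p)%N ->
  (z%:~R == i%:R :> 'F_p) = ((z %% (p : int))%Z == (i : int)).
Proof.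
move=> ip; have p0 := prime_gt0 p_pr.
rewrite {1}(divz_eq z p) intrD intrM.
have -> : ((Posz p)%:~R : 'F_p) = 0 by rewrite -pmulrn; apply: pchar_Fp_0.
rewrite mulr0 add0r.
have pz : (0 < p :> int) by [].
have := ltz_pmod z pz; have := modz_ge0 z (lt0r_neq0 pz).
by case: (z %% p)%Z => // m _ mp; rewrite eq_natr_Fp !modn_small.
Qed.

Lemma cpi_set (i : nat) : (i < p)%N ->
  cpi p i n = \sum_(S : {set 'I_n} | S \subset posI n)
    nat_of_bool ((-1) ^+ odd #|S :\: Pset p n| * (rT p (S :&: Pset p n))%:~R == i%:R :> 'F_p).
Proof.
move=> ip.
transitivity (\sum_(S : {set 'I_n} | S \subset posI n) (ribbon n (comp_of S) %% p == i %% p)%N)%N.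
  rewrite -(big_comp n0 addn (fun b => nat_of_bool (ribbon n b %% p == i %% p)%N)).
  apply: eq_bigr => l _; rewrite -sum1dep_card big_mkcond /=; apply: eq_bigr => t _.
  by case: (is_comp _ _) => //=; case: eqP.
apply: eq_bigr => S SN; have [_ dS _] := comp_ofE n0 SN.
by rewrite -ribbon_set_Fp // eq_natr_Fp /ribbon dS.
Qed.

End Prime.

End RingScope.

(** * Counting descent sets by residue *)

Lemma sum_subset_split (T : finType) (N P : {set T}) (F : {set T} -> {set T} -> nat) :
  P \subset N ->
  \sum_(S : {set T} | S \subset N) F (S :&: P) (S :\: P) =
  \sum_(A : {set T} | A \subset P) \sum_(U : {set T} | U \subset N :\: P) F A U.
Proof.
move=> PN; rewrite pair_big /=.
have AUE (A U : {set T}) : A \subset P -> U \subset N :\: P ->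
    (A :|: U) :&: P = A /\ (A :|: U) :\: P = U.
  move=> AP; rewrite subsetD => /andP[_ dUP].
  rewrite setIUl setDUl (setIidPl AP) (setDidPl dUP) (disjoint_setI0 dUP) setU0.
  by have /eqP -> : A :\: P == set0; rewrite ?setD_eq0 // set0U.
rewrite (reindex_onto (fun u : {set T} * {set T} => u.1 :|: u.2)
   (fun S => (S :&: P, S :\: P))) /=; last by move=> S _; rewrite setID.
apply: eq_big => [[A U]|[A U]] /=.
  apply/andP/andP => [[sub /eqP[EA EU]]|[AP UP]].
    by split; [rewrite -EA subsetIr | rewrite -EU setSD].
  have [-> ->] := AUE _ _ AP UP; rewrite eqxx; split=> //.
  by rewrite subUset (subset_trans AP PN) (subset_trans UP (subsetDl _ _)).
by case/andP=> _ /eqP[-> ->].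
Qed.

(** If a digit [n_j] below the leading one is less than [p - 1], then [(n_j + 1) p^j] is below [n]
    and outside P. Otherwise only the leading digit constrains [x], and it is a quotient, monotone
    in [x]. *)
Lemma mem_pos_Pset_eq p n : prime p -> 0 < n ->
  (posI n :\: Pset p n == set0) = [forall j : 'I_(kdeg p n), digit p j n == p.-1].
Proof.
move=> p_pr n0; have p0 := prime_gt0 p_pr; have p1 := prime_gt1 p_pr.
set k := kdeg p n; have kn : p ^ k <= n by apply: trunc_logP.
have nk : n < p ^ k.+1 by apply: ltn_kdeg.
apply/idP/idP => [Q0|/forallP H].
  apply/forallP => j; apply: contraTT Q0 => nj.
  have lt : (digit p j n).+1 < p by have := digit_lt j n p0; lia.
  have pj : 0 < p ^ j by rewrite expn_gt0 p0.
  have xn : (digit p j n).+1 * p ^ j < n.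
    apply: leq_trans kn; apply: leq_trans (leq_pexp2l p0 (ltn_ord j)).
    by rewrite expnS ltn_pmul2r.
  apply/set0Pn; exists (Ordinal xn); rewrite inE mem_Pset // inE /= muln_gt0 pj /= andbT.
  apply/forallPn; exists (widen_ord (leqnSn _) j) => /=.
  by rewrite -ltnNge {2}/digit mulnK // modn_small.
rewrite setD_eq0; apply/subsetP => x; rewrite inE mem_Pset // => ->.
apply/forallP => j; have [jk|kj] := ltnP j k.
  by rewrite (eqP (H (Ordinal jk))); have := digit_lt j x p0; lia.
have -> : j = k :> nat by have := ltn_ord j; lia.
have lt m : m < p ^ k.+1 -> m %/ p ^ k < p by rewrite ltn_divLR ?expn_gt0 ?p0 // -expnS.
rewrite /digit !modn_small ?lt // ?(ltn_trans (ltn_ord x)) //.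
by apply: leq_div2r; apply: ltnW.
Qed.

Lemma card_pos_Pset p n : prime p -> 0 < n ->
  #|posI n :\: Pset p n| = n.+1 - prodP p n.
Proof.
move=> p_pr n0; rewrite -(card_Pset p_pr n0) cardsD (setIidPr (Pset_pos n p_pr)).
suff -> : #|posI n| = n.-1 by lia.
have -> : posI n = [set~ Ordinal n0].
  by apply/setP=> x; rewrite !inE lt0n.
by rewrite cardsC1 card_ord.
Qed.

Theorem theorem3p1 (p n i : nat) :
  prime p -> (2 <= n)%N -> (i < p)%N ->
  cpi p i n =
  (if (p == 2) || (i == 0%N) ||
      [forall j : 'I_(kdeg p n), digit p j n == p.-1]
   then 2 ^ (n.+1 - prodP p n) *
        #|[set T : {set 'I_n} | (T \subset Pset p n) &&
             ((rT p T %% (p : int))%Z == (i : int))]|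
   else 2 ^ (n - prodP p n) *
        #|[set T : {set 'I_n} | (T \subset Pset p n) &&
             (((rT p T %% (p : int))%Z == (i : int)) ||
              (((rT p T + (i : int)) %% (p : int))%Z == 0))]|)%N.
Proof.
move=> p_pr n2 ip; have n0 : 0 < n := ltnW n2.
rewrite (cpi_set p_pr n0 ip) -mem_pos_Pset_eq // -card_pos_Pset //.
have -> : n - prodP p n = #|posI n :\: Pset p n|.-1 by rewrite card_pos_Pset //; lia.
set Q := posI n :\: Pset p n.
(* The residue depends on the part [A] inside P and on the parity of the part [U] outside. *)
rewrite (sum_subset_split (fun A U => nat_of_bool
  (((-1) ^+ odd #|U| * (rT p A)%:~R)%R == (i%:R)%R :> 'F_p)) (Pset_pos n p_pr)).
rewrite -/Q.
case: ifP => [c|/negbT]; rewrite -[X in _ = _ * X]sum1dep_card big_distrr /=.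
  rewrite [RHS]big_mkcondr /=; apply: eq_bigr => T _.
  rewrite -eq_intr_Fp //; set g := (_ == _ :> 'F_p)%R.
  (* The sign is immaterial here: [-1 = 1] if [p = 2], negation preserves zero if [i = 0], and only
     the empty [U] occurs if [Q] is empty. *)
  transitivity (\sum_(U : {set 'I_n} | U \subset Q) nat_of_bool g).
    apply: eq_bigr => U UQ; congr (nat_of_bool _).
    case/orP: c => [c|/eqP Q0]; last first.
      by move: UQ; rewrite Q0 subset0 => /eqP->; rewrite cards0 mul1r.
    case: (odd _); rewrite ?mul1r // expr1 mulN1r.
    case/orP: c => [/eqP p2|/eqP i0]; last by rewrite /g i0 oppr_eq0.
    by rewrite oppr_pchar2 // -p2 pchar_Fp.
  rewrite (eq_bigl (fun U => U \in powerset Q)); last by move=> U; rewrite powersetE.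
  by rewrite sum_nat_const card_powerset; case: g; rewrite ?muln1 ?muln0.
rewrite !negb_or => /andP[/andP[p2 i0] Q0].
rewrite [RHS]big_mkcondr /=; apply: eq_bigr => T _.
(* As [Q] is nonempty, both signs occur equally often. *)
rewrite (sum_parity_subset (fun b => nat_of_bool
  (((-1) ^+ b * (rT p T)%:~R)%R == (i%:R)%R :> 'F_p)) Q0).
rewrite expr0 mul1r expr1 mulN1r -eq_intr_Fp //.
have -> : (((rT p T + (i : int))%R %% (p : int))%Z == 0) =
  ((- (rT p T)%:~R)%R == (i%:R)%R :> 'F_p).
  rewrite -eq_intr_Fp ?prime_gt0 // intrD addr_eq0 eqr_oppLR.
  by rewrite pmulrn.
set r := ((rT p T)%:~R)%R.
have [ri|] := eqVneq r (i%:R)%R; last first.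
  by move=> _; case: (_ == _); rewrite ?muln1 ?muln0.
(* The two congruences exclude each other, so their indicators add up to that of the disjunction:
   otherwise [p] would divide [2 * i], with [p] odd and [0 < i < p]. *)
rewrite orTb ri; have -> : (- i%:R == i%:R :> 'F_p)%R = false; last by rewrite muln1.
apply/negbTE; rewrite eq_sym -subr_eq0 opprK -natrD.
rewrite -[0%R]/((0%:R)%R) eq_natr_Fp // mod0n -/(_ %| _) addnn -mul2n Euclid_dvdM //.
rewrite negb_or dvdn_prime2 // p2 /=.
by apply/negP=> /dvdn_leq; lia.
Qed.
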